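(* A regular Hausdorff space $X$ is an $\alpha$-space if and only if $\mathcal{K}(X)$ is an $\alpha$-space.
   Context: $\mathcal{K}(X)$ is the set of nonempty compact subsets of $X$ with the Vietoris topology (base: $\langle U_1,\dots,U_k\rangle=\{K: K\subset\bigcup_i U_i,\ K\cap U_j\neq\emptyset\ \forall j\}$, $U_i$ open in $X$). A space $Y$ with topology $\tau_Y$ is an $\alpha$-space if there is a function $g:\mathbb{N}\times Y\to\tau_Y$ such that (i) $\bigcap_{m\in\mathbb{N}}g(m,x)=\{x\}$ for each $x\in Y$, and (ii) if $y\in g(m,x)$ then $g(m,y)\subset g(m,x)$. *)

(* Defs.v *)
From HB Require Import structures.
From mathcomp Require Import all_boot all_order.
From mathcomp Require Import all_classical topology.
Set Implicit Arguments. Unset Strict Implicit. Unset Printing Implicit Defensive.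
Local Open Scope classical_set_scope.

Definition alpha_space_on (Y : Type) (opn : set (set Y)) : Prop :=
  exists g : nat -> Y -> set Y,
    (forall m x, opn (g m x)) /\
    (forall x, \bigcap_(m in [set: nat]) g m x = [set x]) /\
    (forall m x y, g m x y -> g m y `<=` g m x).

Definition alpha_space (T : topologicalType) : Prop :=
  alpha_space_on (@open T).

Record cpt_nonempty (X : topologicalType) := CptNE {
  cset :> set X;
  cset_neq0 : cset !=set0;
  cset_compact : compact cset }.

Definition vietoris_basic (X : topologicalType) (us : seq (set X))
  : set (cpt_nonempty X) :=
  [set K | (cset K `<=` \bigcup_(U in [set` us]) U) /\
           (forall U, U \in us -> cset K `&` U !=set0)].

(* Vietoris topology: the topology generated by the basic sets, i.e. the
   unions of basic sets (the basic sets form a base) *)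
Definition vietoris_open (X : topologicalType) : set (set (cpt_nonempty X)) :=
  [set W | forall K, W K -> exists us : seq (set X),
      (forall U, U \in us -> open U) /\ vietoris_basic us K /\
      vietoris_basic us `<=` W].

(* Main.v *)
(* Singletons embed X into K(X), which gives one direction.

   Conversely let g be an alpha-function of X, decreasing in m. By regularity
   and a well-ordering of X, each level k gets neighborhoods U k y, with
   closure (U k y) included in g k y, that are determined by an ordinal rank of
   y; this rank cannot increase when passing from y to a point of U k y in the
   same g k-class. Each compact L gets a Vietoris neighborhood by covering L
   with finitely many sets, the intersections of U k w over k <= m, w in L, and
   by asking to keep hitting the complement of the closure of every finite
   union of sets U k w, k <= m, that L does not lie in. G m K is the set of all
   compacta reachable from K by finite chains of such moves: it is open and
   transitive by construction.

   Let K' be in G m K for all m. Points of K' lie in g m K for all m, hence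
   in K by compactness. If x is in K but not in K', choose k with x outside
   g k K', and a finite Y in K' such that the sets U k y, y in Y, cover K'. When
   m is large, any point of K dominating y in Y at level m is close to y and so
   has rank at most that of y. Ranks decrease along a chain from K to K', so
   the ancestors of y in all compacta of the chain have exactly the rank of y,
   hence the same U k. So the complement of the closure of the union of the
   U k y is hit by every compactum of the chain, including K', which is
   absurd. *)
Require Import Defs.
From HB Require Import structures.
From mathcomp Require Import all_boot all_order.
From mathcomp Require Import all_classical topology.
From mathcomp Require Import wochoice.
From Stdlib Require Import Relation_Operators Operators_Properties.
Set Implicit Arguments. Unset Strict Implicit. Unset Printing Implicit Defensive.
Local Open Scope classical_set_scope.

(** * Compactness, well-orders and Vietoris neighborhoods *)

Lemma compact_finite_subcover (X : topologicalType) (K : set X)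
    (O : X -> set X) :
  compact K -> (forall w, K w -> nbhs w (O w)) ->
  exists s : seq X, (forall w, w \in s -> K w) /\
    K `<=` \bigcup_(w in [set` s]) O w.
Proof.
move=> cK nO; apply: contrapT => nocover.
pose D := [set s : seq X | forall w, w \in s -> K w].
pose B (s : seq X) := K `\` \bigcup_(w in [set` s]) O w.
have D0 : D [::] by [].
have BF : ProperFilter (filter_from D B).
  apply: filter_from_proper; last first.
    move=> s Ds; apply: contrapT => /set0P/negP; rewrite negbK => /eqP B0.
    apply: nocover; exists s; split=> // x Kx; apply: contrapT => nx.
    by have : B s x by []; rewrite B0.
  apply: filter_from_filter; first by exists [::].
  move=> s t Ds Dt; exists (s ++ t).
    by move=> w; rewrite mem_cat => /orP[/Ds|/Dt].
  move=> x [Kx nx]; split; split=> // -[w /= ws Ox]; apply: nx; exists w => //=;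
    by rewrite mem_cat ws ?orbT.
have FK : filter_from D B K by exists [::] => // x [].
have [p [Kp clp]] := cK _ BF FK.
have [|x [[_ nx] Opx]] := clp (B [:: p]) (O p) _ (nO p Kp).
  by exists [:: p] => // w; rewrite inE => /eqP ->.
by apply: nx; exists p => //=; rewrite inE.
Qed.

(** [well_order] only gives each nonempty set a unique minimum; the three laws are read off from
    sets of at most three points. *)
Lemma well_order_partial_order (T : eqType) (R : rel T) :
  well_order R -> [/\ reflexive R, transitive R & antisymmetric R].
Proof.
move=> wo.
have Rr : reflexive R.
  move=> x; have [|z [[/= /eqP -> lb] _]] := wo (pred1 x).
    by exists x; rewrite inE.
  by apply: lb; rewrite inE.
have Ra : antisymmetric R.
  move=> x y /andP[xy yx]; have [|z [_ uz]] := wo (pred2 x y).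
    by exists x; rewrite !inE eqxx.
  rewrite -[LHS](uz x) -?[RHS](uz y) //; split; rewrite ?inE ?eqxx ?orbT //.
    by move=> w; rewrite !inE => /orP[] /eqP ->.
  by move=> w; rewrite !inE => /orP[] /eqP ->.
split=> // y x z xy yz.
have [|u [[Au lb] _]] := wo [pred u | [|| u == x, u == y | u == z]].
  by exists x; rewrite inE eqxx.
have ux : R u x by apply: lb; rewrite inE eqxx.
have uy : R u y by apply: lb; rewrite inE eqxx orbT.
have uz : R u z by apply: lb; rewrite inE eqxx !orbT.
move: Au; rewrite inE => /or3P[] /eqP eu; rewrite eu in ux uy uz => //.
  by rewrite (Ra x y) // xy ux.
by rewrite -(Ra y z) // yz uy.
Qed.

Lemma open_initial_bigcap (X : topologicalType) (O : nat -> set X) m :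
  (forall k, open (O k)) -> open [set x | forall k, (k <= m)%N -> O k x].
Proof.
move=> oO; elim: m => [|m IH].
  rewrite (_ : mkset _ = O 0) //; apply/seteqP; split=> x; first exact.
  by move=> Ox k; rewrite leqn0 => /eqP ->.
rewrite (_ : mkset _ = [set x | forall k, (k <= m)%N -> O k x] `&` O m.+1).
  exact: openI.
apply/seteqP; split=> x.
  by move=> Nx; split=> [k km|]; apply: Nx => //; exact: leqW.
by move=> [Nx Ox] k; rewrite leq_eqVlt => /orP[/eqP -> //|]; exact: Nx.
Qed.

Lemma vietoris_basic_hits (X : topologicalType) (L : cpt_nonempty X)
    (O : set X) (s : seq (set X)) :
  open O -> cset L `<=` O -> (forall B, B \in s -> open B) ->
  exists us : seq (set X), [/\ forall U, U \in us -> open U,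
    vietoris_basic us L &
    forall M, vietoris_basic us M -> cset M `<=` O /\
      forall B, B \in s -> cset L `&` B !=set0 -> cset M `&` B !=set0].
Proof.
move=> oO LO os.
(* Each [B] is cut down to [O] so that the union of the list stays inside [O]. *)
exists (O :: [seq B `&` O | B <- s & `[< cset L `&` B !=set0 >]]); split.
- move=> U; rewrite inE => /orP[/eqP -> //|/mapP[B]].
  by rewrite mem_filter => /andP[_ /os oB] ->; apply: openI.
- split=> [x /LO Ox|U]; first by exists O => //=; rewrite inE eqxx.
  rewrite inE => /orP[/eqP ->|/mapP[B]].
    by have [x Lx] := cset_neq0 L; exists x; split => //; apply: LO.
  rewrite mem_filter => /andP[/asboolP[x [Lx Bx]] _] ->.
  by exists x; split=> //; split=> //; apply: LO.
- move=> M [sub hit]; split=> [x /sub[U /=]|B Bs LB].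
    by rewrite inE => /orP[/eqP -> //|/mapP[B _ ->] []].
  have [|x [Mx [Bx _]]] := hit (B `&` O); last by exists x.
  rewrite inE; apply/orP; right; apply/mapP; exists B => //.
  by rewrite mem_filter Bs andbT; apply/asboolP.
Qed.

Lemma eq_cpt_nonempty (X : topologicalType) (K L : cpt_nonempty X) :
  cset K = cset L -> K = L.
Proof.
case: K L => [K K0 cK] [L L0 cL] /= KL.
by subst L; congr CptNE; exact: Prop_irrelevance.
Qed.

(** * Decreasing alpha-functions and ranks *)

Section DecreasingAlphaFunction.
Variables (X : topologicalType) (g : nat -> X -> set X).
Hypothesis g_open : forall m x, open (g m x).
Hypothesis g_self : forall m x, g m x x.
Hypothesis g_trans : forall m x y, g m x y -> g m y `<=` g m x.
Hypothesis g_anti : forall m n x, (m <= n)%N -> g n x `<=` g m x.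
Hypothesis g_sep : forall x y, (forall m, g m x y) -> y = x.

(** Finitely many sets [g (h v) v] missing [y] cover [C]; at the largest [h v], transitivity keeps
    [y] out of every [g m w]. *)
Lemma compact_escape (C : set X) (y : X) :
  compact C -> ~ C y -> exists m, forall w, C w -> ~ g m w y.
Proof.
move=> cC nCy.
have /choice[h hP] : forall w, exists m, C w -> ~ g m w y.
  move=> w; have [Cw|] := pselect (C w); last by exists 0.
  apply: contrapT => /forallNP no; apply: nCy; suff -> : y = w by [].
  by apply: g_sep => m; have /not_implyP[_ /contrapT] := no m.
have [s [sC cov]] := @compact_finite_subcover X C (fun w => g (h w) w) cC
  (fun w _ => open_nbhs_nbhs (conj (g_open (h w) w) (g_self (h w) w))).
exists (\max_(w <- s) h w) => w Cw gy.
have [v /= vs vw] := cov _ Cw.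
apply: (hP v (sC _ vs)); apply: (g_trans vw); apply: g_anti gy.
exact: leq_bigmax_seq.
Qed.

(* [r k y] is the first [w], in a well-order of [X], that lies in the class of
   [y] (i.e. [g k w = g k y]) and whose chosen neighborhood, with closure in
   [g k w], contains [y]; that neighborhood is [U k y]. *)
Lemma exists_ranked_nbhds : regular_space X ->
  exists (R : rel X) (r : nat -> X -> X) (U : nat -> X -> set X),
  [/\ [/\ reflexive R, transitive R & antisymmetric R],
      forall k y, [/\ open (U k y), U k y y & closure (U k y) `<=` g k y],
      forall k y w, U k y w -> g k w y -> R (r k w) (r k y) &
      forall k y w, r k w = r k y -> U k w = U k y].
Proof.
move=> regX; have [R woR] := well_ordering_principle X.
have /choice[V VP] : forall kx : nat * X, exists V : set X,
    [/\ open V, V kx.2 & closure V `<=` g kx.1 kx.2].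
  move=> [k x] /=.
  have [A Ax clA] :=
    regX x (g k x) (open_nbhs_nbhs (conj (g_open k x) (g_self k x))).
  exists A°; split; [exact: open_interior | exact: Ax |].
  by apply: subset_trans clA; apply: closureS; exact: interior_subset.
pose E k y w := g k w = g k y /\ V (k, w) y.
have /choice[r rP] : forall ky : nat * X, exists r,
    E ky.1 ky.2 r /\ forall w, E ky.1 ky.2 w -> R r w.
  move=> [k y] /=; have [|r [[Er lb] _]] := woR [pred w | `[< E k y w >]].
    by exists y; apply/asboolP; split=> //=; have [] := VP (k, y).
  exists r; split; first exact/asboolP.
  by move=> w Ew; apply: lb; exact/asboolP.
exists R, (fun k y => r (k, y)), (fun k y => V (k, r (k, y))).
split; first exact: well_order_partial_order.
- move=> k y; have [[/= gr Vy] _] := rP (k, y).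
  by have [? _ cl] := VP (k, r (k, y)); split=> //; rewrite -gr.
- move=> k y w Uw gwy; have [[/= gr Vy] _] := rP (k, y).
  (* [r (k, y)] is a candidate for [w] too: its neighborhood contains [w], and [g k w = g k y] by
     inclusion both ways. *)
  have [_ /= min] := rP (k, w); apply: min; split=> //.
  rewrite gr; apply/seteqP; split; apply: g_trans => //.
  have [_ _ cl] := VP (k, r (k, y)); move: cl => /=; rewrite gr; apply.
  exact: subset_closure.
- by move=> k y w ->.
Qed.

(** * Chains of compacta *)

Section Chains.
Variables (R : rel X) (r : nat -> X -> X) (U : nat -> X -> set X).
Hypothesis R_refl : reflexive R.
Hypothesis R_trans : transitive R.
Hypothesis R_anti : antisymmetric R.
Hypothesis U_open : forall k y, open (U k y).
Hypothesis U_self : forall k y, U k y y.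
Hypothesis U_closure : forall k y, closure (U k y) `<=` g k y.
Hypothesis U_rank : forall k y w, U k y w -> g k w y -> R (r k w) (r k y).
Hypothesis U_r : forall k y w, r k w = r k y -> U k w = U k y.

Let U_sub k y : U k y `<=` g k y.
Proof. by move=> x Ux; apply: U_closure; exact: subset_closure. Qed.

(** Ranks are compared only inside a class: [g j w y] and [g j y w] together mean
    [g j w = g j y]. *)
Definition dominates m w y := forall j, (j <= m)%N ->
  g j w y /\ (g j y w -> R (r j y) (r j w)).

Lemma dominates_trans m a b c :
  dominates m a b -> dominates m b c -> dominates m a c.
Proof.
move=> ab bc j jm; have [gab rab] := ab j jm; have [gbc rbc] := bc j jm.
split=> [|gca]; first exact: (g_trans gab).
apply: (@R_trans (r j b)); first by apply: rbc; exact: (g_trans gca).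
by apply: rab; exact: (g_trans gbc).
Qed.

(** [U k y w0] closes a cycle, so [w0], [w], [y] share a class at level [k], and there [r k y],
    [r k w], [r k w0], [r k y] increase weakly in this order. *)
Lemma dominates_between m k w0 w y : (k <= m)%N -> dominates m w0 w ->
  dominates m w y -> U k y w0 -> U k w = U k y.
Proof.
move=> km d0 d1 Uw0; apply: U_r; apply: R_anti.
have [g0 r0] := d0 k km; have [g1 r1] := d1 k km.
have gyw0 : g k y w0 by exact: U_sub.
have gw0y : g k w0 y by exact: (g_trans g0).
have rw0 := U_rank Uw0 gw0y.
have -> /= : R (r k w) (r k y).
  by apply: R_trans rw0; apply: r0; exact: (g_trans g1).
by apply: r1; exact: (g_trans gyw0).
Qed.

Definition small_nbhd m w := [set x | forall k, (k <= m)%N -> U k w x].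

Lemma small_nbhd_dominates m w y : small_nbhd m w y -> dominates m w y.
Proof.
by move=> Ny j jm; split; [exact: U_sub (Ny j jm) | exact: U_rank (Ny j jm)].
Qed.

Lemma small_nbhd_open m w : open (small_nbhd m w).
Proof. exact: open_initial_bigcap. Qed.

Variable F : nat -> cpt_nonempty X -> seq X.
Hypothesis F_sub : forall m (L : cpt_nonempty X) w, w \in F m L -> cset L w.
Hypothesis F_cover : forall m (L : cpt_nonempty X) x, cset L x ->
  exists2 w, w \in F m L & small_nbhd m w x.

Definition far k (s : seq X) := ~` closure (\bigcup_(w in [set` s]) U k w).

Definition step m (L M : cpt_nonempty X) :=
  (forall x, cset M x -> exists2 w, w \in F m L & small_nbhd m w x) /\
  (forall k (p : pred X), (k <= m)%N ->
    cset L `&` far k [seq w <- F m L | p w] !=set0 ->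
    cset M `&` far k [seq w <- F m L | p w] !=set0).

Lemma step_nbhd m L : exists us : seq (set X),
  [/\ forall V, V \in us -> open V, vietoris_basic us L &
      forall M, vietoris_basic us M -> step m L M].
Proof.
pose O := \bigcup_(w in [set` F m L]) small_nbhd m w.
(* Filtering [F m L] by any predicate amounts to a mask, so finitely many open sets suffice. *)
pose s := [seq far k (mask (tval b) (F m L)) |
  k <- iota 0 m.+1, b <- enum {: (size (F m L)).-tuple bool}].
have [|x /(@F_cover m)[w wF Nx]|B|us [us_open usL usP]] :=
  @vietoris_basic_hits X L O s.
- by apply: bigcup_open => w _; exact: small_nbhd_open.
- by exists w.
- move=> /allpairsP[[k b] [_ _ ->]].
  by apply: closed_openC; exact: closed_closure.
exists us; split=> // M /usP[MO Mhit]; split=> [x /MO[w wF Nx]|k p km].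
  by exists w.
apply: Mhit; rewrite filter_mask.
have szp : size [seq p i | i <- F m L] == size (F m L) by rewrite size_map.
apply/allpairsP; exists (k, Tuple szp); split=> //.
  by rewrite mem_iota add0n ltnS.
by rewrite mem_enum.
Qed.

Definition reach m (K : cpt_nonempty X) : set (cpt_nonempty X) :=
  clos_refl_trans _ (step m) K.

Lemma reach_open m K : vietoris_open (reach m K).
Proof.
move=> L KL; have [us [us_open usL usP]] := step_nbhd m L.
exists us; split=> //; split=> // M /usP LM.
by apply: rt_trans KL _; exact: rt_step.
Qed.

Lemma step_dominated m (L M : cpt_nonempty X) x : step m L M -> cset M x ->
  exists2 w, w \in F m L & dominates m w x.
Proof.
by move=> [LM _] /LM[w wF /small_nbhd_dominates]; exists w.
Qed.

Lemma dominates_refl m x : dominates m x x.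
Proof. by move=> j jm; split. Qed.

Lemma reach_dominated m (K L : cpt_nonempty X) x : reach m K L -> cset L x ->
  exists2 w, cset K w & dominates m w x.
Proof.
rewrite /reach => KL; elim: KL x => {K L} [K L KL x|K x|K L M _ IK _ IL x].
- by move=> /(step_dominated KL)[w /F_sub]; exists w.
- by exists x => //; exact: dominates_refl.
- move=> /IL[w /IK[v Kv vw] wx]; exists v => //; exact: dominates_trans wx.
Qed.

Lemma dominates_g m w x : dominates m w x -> g m w x.
Proof. by move=> /(_ m (leqnn m))[]. Qed.

Lemma reach_sub (K K' : cpt_nonempty X) :
  (forall m, reach m K K') -> cset K' `<=` cset K.
Proof.
move=> KK' y K'y; apply: contrapT => nKy.
have [m mP] := compact_escape (@cset_compact _ K) nKy.
by have [w /mP + /dominates_g] := reach_dominated (KK' m) K'y.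
Qed.

(* Along a chain from [K] to [K'], the points above [y] in [Y] keep the rank
   of [y], so [far k Y] is at each stage one of the sets that [step] controls. *)
Lemma reach_hits_far m k (K0 K K' : cpt_nonempty X) (Y : seq X) :
  (k <= m)%N -> (forall y, y \in Y -> cset K' y) ->
  (forall y w, y \in Y -> cset K0 w -> g m w y -> U k y w) ->
  (forall x, cset K x -> exists2 w0, cset K0 w0 & dominates m w0 x) ->
  reach m K K' -> cset K `&` far k Y !=set0 -> cset K' `&` far k Y !=set0.
Proof.
(* The chain is unrolled from its start: [K] advances while [K0] stays fixed, with [above] as
   invariant. *)
move=> km YK' near above rKK'; have KK' := clos_rt_rt1n _ _ _ _ rKK'.
elim: KK' YK' above {rKK'} => {K K'} [//|K L K' KL LK' IH YK' above Khit].
apply: IH => // [x /(step_dominated KL)[w /F_sub/above[w0 K0w0 ww0] wx]|].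
  by exists w0 => //; exact: dominates_trans wx.
pose p w := `[< exists2 y, y \in Y & U k w = U k y >].
suff farE : far k [seq w <- F m K | p w] = far k Y.
  by move: Khit; rewrite -farE; apply: (KL.2).
congr (~` closure _); apply/seteqP; split=> x [w /=].
  by rewrite mem_filter => /andP[/asboolP[y yY ->] _] Ux; exists y.
(* Tracing [w] back along the chain gives [u] in [F m K], squeezed between some [w0] in [K0] and
   [w]. *)
move=> wY Ux.
have [v Lv vw] := reach_dominated (clos_rt1n_rt _ _ _ _ LK') (YK' _ wY).
have [u uF uv] := step_dominated KL Lv.
have uw := dominates_trans uv vw.
have [w0 K0w0 w0u] := above _ (F_sub uF).
have Uu : U k u = U k w.
  apply: (dominates_between km w0u uw); apply: near => //.
  by apply: dominates_g; exact: dominates_trans uw.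
exists u; last by rewrite Uu.
by rewrite /= mem_filter uF andbT; apply/asboolP; exists w.
Qed.

Lemma reach_sup (K K' : cpt_nonempty X) :
  (forall m, reach m K K') -> cset K `<=` cset K'.
Proof.
move=> KK' x Kx; apply: contrapT => nK'x.
have [k kP] := compact_escape (@cset_compact _ K') nK'x.
have [Y [YK' Ycov]] := compact_finite_subcover (@cset_compact _ K')
  (fun w _ => open_nbhs_nbhs (conj (U_open k w) (U_self k w))).
have /choice[h hP] : forall y, exists m, forall w,
    cset K w -> g m w y -> U k y w.
  move=> y; have [||m mP] := @compact_escape (cset K `&` ~` U k y) y.
  - by apply: compact_closedI; [exact: cset_compact | exact: open_closedC].
  - by move=> [_]; apply; exact: U_self.
  by exists m => w Kw gwy; apply: contrapT => nU; exact: (mP w).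
(* [m >= k] lets [step] control [far k]; [m >= h y] puts into [U k y] every [w] in [K] with
   [g m w y]. *)
pose m := maxn k (\max_(y <- Y) h y).
have [|y w yY Kw gwy|w Kw||z [K'z]] :=
  @reach_hits_far m k K K K' Y _ YK' _ _ (KK' m).
- exact: leq_maxl.
- apply: hP => //; apply: g_anti gwy; apply: leq_trans (leq_maxr _ _).
  exact: leq_bigmax_seq.
- by exists w => //; exact: dominates_refl.
(* [x] lies in [far k Y], since [closure (U k y)] is inside [g k y], which misses [x]. *)
- exists x; split=> //; move=> clx.
  have clU : closed (\bigcup_(y in [set` Y]) closure (U k y)).
    by apply: closed_bigcup => [|y _]; [exact: finite_seq|exact: closed_closure].
  have [y yY /U_closure] : (\bigcup_(y in [set` Y]) closure (U k y)) x.
    apply: clU; apply: closureS clx; apply: subset_bigcup => y _.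
    exact: subset_closure.
  by apply: kP; exact: YK'.
- by apply; apply: subset_closure; exact: Ycov.
Qed.

End Chains.

Lemma decreasing_alpha_vietoris :
  regular_space X -> alpha_space_on (@vietoris_open X).
Proof.
move=> regX.
have [R [r [U [[Rr Rt Ra] UP Urank Ur]]]] := exists_ranked_nbhds regX.
have Uo k y : open (U k y) by case: (UP k y).
have Us k y : U k y y by case: (UP k y).
have Uc k y : closure (U k y) `<=` g k y by case: (UP k y).
have /choice[F FP] : forall mL : nat * cpt_nonempty X, exists s : seq X,
    (forall w, w \in s -> cset mL.2 w) /\
    cset mL.2 `<=` \bigcup_(w in [set` s]) small_nbhd U mL.1 w.
  move=> [m L] /=; apply: compact_finite_subcover; first exact: cset_compact.
  move=> w _; apply: open_nbhs_nbhs; split; first exact: small_nbhd_open.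
  by move=> k _; exact: Us.
pose F' m L := F (m, L).
have Fs m (L : cpt_nonempty X) w : w \in F' m L -> cset L w.
  exact: (FP (m, L)).1.
have Fc m (L : cpt_nonempty X) x : cset L x ->
    exists2 w, w \in F' m L & small_nbhd U m w x.
  by move=> /(FP (m, L)).2[w wF Nx]; exists w.
exists (reach U F'); split; first by move=> m K; exact: (reach_open Uo Fc).
split=> [K|m K L KL M LM]; last exact: rt_trans KL LM.
apply/seteqP; split=> [L KL|_ -> m _]; last exact: rt_refl.
have KL' m : reach U F' m K L by exact: KL.
apply: eq_cpt_nonempty; apply/seteqP; split.
  exact: (reach_sub Rr Rt Uc Urank Fs KL').
exact: (reach_sup Rr Rt Ra Uo Us Uc Urank Ur Fs KL').
Qed.

End DecreasingAlphaFunction.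

(** * The two directions of the equivalence *)

Lemma alpha_vietoris (X : topologicalType) :
  regular_space X -> alpha_space X -> alpha_space_on (@vietoris_open X).
Proof.
move=> regX [g [go [gc gt]]].
have gs m x : g m x x.
  by have : [set x] x by []; rewrite -gc; exact.
(* Intersecting the levels up to [m] makes the function decreasing and keeps its values open. *)
pose g' m x := [set y | forall k, (k <= m)%N -> g k x y].
apply: (@decreasing_alpha_vietoris X g') => //.
- by move=> m x; exact: open_initial_bigcap.
- by move=> m x k _; exact: gs.
- by move=> m x y gxy z gyz k km; apply: (gt k x y); [exact: gxy|exact: gyz].
- by move=> m n x mn y gxy k km; apply: gxy; exact: leq_trans km mn.
- move=> x y gxy; have : [set x] y by rewrite -gc => k _; exact: (gxy k).
  by [].
Qed.

(** [G] is pulled back along [x |-> {x}]. The finitely many members of a basic set around [{y}] all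
    contain [y], so their intersection is a neighborhood of [y], which gives openness. *)
Lemma vietoris_alpha (X : topologicalType) :
  alpha_space_on (@vietoris_open X) -> alpha_space X.
Proof.
move=> [G [Go [Gc Gt]]].
pose pt (x : X) := CptNE (ex_intro [set x] x erefl) (@compact_set1 X x).
exists (fun m x => [set y | G m (pt x) (pt y)]); split; [|split].
- move=> m x; rewrite openE => y /Go[us [us_open [[sub hit] usG]]].
  have : \forall z \near y, forall V, V \in us -> V z.
    have usy V : V \in us -> nbhs y V.
      move=> Vus; apply: open_nbhs_nbhs; split; first exact: us_open.
      by have [_ [-> ]] := hit V Vus.
    elim: {us_open sub hit usG} us usy => [|V us IH] usy; first exact: nearW.
    have ny := filterI (usy V (mem_head V us))
      (IH (fun W Wus => usy W (@mem_behead _ (V :: us) W Wus))).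
    apply: filterS (ny _) => z [Vz usz] W.
    by rewrite inE => /orP[/eqP -> //|]; exact: usz.
  apply: filterS => z usz; apply: usG; split=> [_ ->|V Vus].
    by have [V Vus _] := sub y erefl; exists V => //; exact: usz.
  by exists z; split=> //; exact: usz.
- move=> x; apply/seteqP; split=> [y Gxy|_ -> m _].
    have : [set pt x] (pt y) by rewrite -Gc => m _; exact: Gxy.
    by move=> xy; change (cset (pt x) y); rewrite -xy.
  by have : [set pt x] (pt x) by []; rewrite -Gc; exact.
- by move=> m x y Gxy z Gyz; exact: Gt Gxy _ Gyz.
Qed.

Theorem theorem3p14 (X : topologicalType) :
  @regular_space X -> hausdorff_space X ->
  (alpha_space X <-> alpha_space_on (@vietoris_open X)).
Proof.
move=> regX _; split; [exact: alpha_vietoris | exact: vietoris_alpha].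
Qed.
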